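(* Let $Y$ be a Bernoulli random variable with success probability $p_1$, let $0<q<1$, $x\in[0,1]$, and let $n,r$ be integers with $0\le r\le n$. Then $$B_{r,n}^{Y}(x,q)=[x]_q^{r}\binom{n}{r}\sum_{m=0}^{n-r}p_1^{m}\,\bigl(1-[x]_{q^{-1}}\bigr)_m\left\{{n-r\atop m}\right\}.$$
   Context: $q$-numbers: $[x]_q=\frac{q^x-1}{q-1}$ and $[x]_{q^{-1}}=\frac{q^{-x}-1}{q^{-1}-1}$; one has $[1-x]_q=1-[x]_{q^{-1}}$. Probabilistic $q$-Bernstein polynomials $B_{r,n}^Y(x,q)$ associated with $Y$: $\sum_{n=r}^{\infty}B_{r,n}^{Y}(x,q)\frac{v^n}{n!}=\frac{(v[x]_q)^r}{r!}\left(\mathrm{E}[e^{vY}]\right)^{[1-x]_q}$, where the power is the power series in $v$ with constant term $1$. For $Y\sim\mathrm{Bernoulli}(p_1)$, $P(Y=1)=p_1$, $P(Y=0)=1-p_1$ and $\mathrm{E}[e^{vY}]=1-p_1+p_1e^v$. $\left\{{n\atop m}\right\}$ are the Stirling numbers of the second kind: $\sum_{n=m}^{\infty}\left\{{n\atop m}\right\}\frac{v^n}{n!}=\frac{(e^v-1)^m}{m!}$. $(z)_m=z(z-1)\cdots(z-m+1)$, $(z)_0=1$, is the falling factorial. *)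

(* Defs.v *)
From HB Require Import structures.
From mathcomp Require Import all_boot all_order all_algebra.
From mathcomp Require Export all_classical all_reals all_analysis.

Set Implicit Arguments.
Unset Strict Implicit.
Unset Printing Implicit Defensive.

Import Order.TTheory GRing.Theory Num.Theory.
Import numFieldNormedType.Exports.

Local Open Scope classical_set_scope.
Local Open Scope ring_scope.

(* [x]_q; the number [x]_{q^-1} is qnum q^-1 x. *)
Definition qnum (R : realType) (q x : R) : R := (q `^ x - 1) / (q - 1).

(* (z)_m for a real z (the library's z ^_ m is for natural z only). *)
Definition falling (R : realType) (z : R) (m : nat) : R :=
  \prod_(i < m) (z - i%:R).

(* sum_(n >= r) a n * v ^ n / n! = F v for all v in a neighbourhood of 0. *)
Definition has_egf (R : realType) (r : nat) (F : R -> R) (a : nat -> R) : Prop :=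
  \forall v \near (0 : R),
    (fun N : nat => \sum_(r <= n < N) a n * (v ^+ n / n`!%:R)) @ \oo --> F v.

(* A sequence with exponential generating function F, summed from n = r.  When
   one exists, its terms of index n >= r are unique; those of index n < r are
   unspecified.  If F has no such expansion, the result is the zero sequence. *)
Definition egf_coef (R : realType) (r : nat) (F : R -> R) : nat -> R :=
  xget (fun=> 0) [set a | has_egf r F a].

Definition stirling2 (R : realType) (n m : nat) : R :=
  egf_coef m (fun v : R => (expR v - 1) ^+ m / m`!%:R) n.

(* 'M_P Y v = E[exp (v Y)], assumed to be finite for v near 0.  It is then
   positive and equal to 1 at v = 0, so its real power `^ is the branch whose
   power series in v has constant term 1. *)
Definition probBernstein (d : measure_display) (T : measurableType d)
    (R : realType) (P : probability T R) (Y : {RV P >-> R})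
    (r n : nat) (x q : R) : R :=
  egf_coef r (fun v : R =>
    (v * qnum q x) ^+ r / r`!%:R * (fine ('M_P Y v) `^ qnum q (1 - x))) n.

Definition is_bernoulli (d : measure_display) (T : measurableType d)
    (R : realType) (P : probability T R) (Y : {RV P >-> R}) (p : R) : Prop :=
  P (Y @^-1` [set 1]) = p%:E /\ P (Y @^-1` [set 0]) = (1 - p)%:E.

(* Main.v *)
Require Import Defs.
From HB Require Import structures.
From mathcomp Require Import all_boot all_order all_algebra.
From mathcomp Require Import all_classical all_reals all_analysis.
From mathcomp Require Import measurable_realfun ring lra.

(** If [f j] is the j-th derivative of [f 0], the k-th derivative of
    [f 0 (e^v - 1)] is [sum_j S(k,j) e^(jv) f j (e^v - 1)], where S satisfies the
    recurrence [S(k+1,j+1) = (j+1) S(k,j+1) + S(k,j)].  Since [S(k,j) j! <= k! C(k,j)],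
    bounds [|f j| <= C M^j j!] near 0 pass to the composite, whose Taylor series
    at 0 therefore converges to it.  With [f 0 u = u^m / m!] this shows that the
    S(k,m) are the Stirling numbers of the second kind; with
    [f 0 u = (1 + p u)^a], whose m-th derivative at 0 is [p^m (a)_m], it expands
    [E[e^(vY)]^a = (1 + p (e^v - 1))^a] for [a = [1-x]_q = 1 - [x]_(1/q)].  The
    monomial factor [(v [x]_q)^r / r!] shifts the index by r. *)

Set Implicit Arguments.
Unset Strict Implicit.
Unset Printing Implicit Defensive.

Import Order.TTheory GRing.Theory Num.Theory.
Import numFieldNormedType.Exports.

Local Open Scope classical_set_scope.
Local Open Scope ring_scope.

(** * Taylor expansion with geometric control of the remainder *)

(** The Taylor sum is differentiated in its centre [t]. Differentiating [(v - t)^k / k!] cancels the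
    contribution of the previous term, so the sum telescopes and only the top term remains. *)
Lemma is_derive_taylor (R : realType) (G : nat -> R -> R) (v s : R) (N : nat) :
  (forall k, is_derive s 1 (G k) (G k.+1 s)) ->
  is_derive s 1 (fun t => \sum_(0 <= k < N.+1) G k t * ((v - t) ^+ k / k`!%:R))
    (G N.+1 s * ((v - s) ^+ N / N`!%:R)).
Proof.
move=> dG; elim: N => [|N IH].
  have -> : (fun t => \sum_(0 <= k < 1) G k t * ((v - t) ^+ k / k`!%:R)) = G 0%N.
    by apply/funext => t; rewrite big_nat1 expr0 fact0 divr1 mulr1.
  by rewrite expr0 fact0 divr1 mulr1.
have -> : (fun t => \sum_(0 <= k < N.+2) G k t * ((v - t) ^+ k / k`!%:R)) =
   (fun t => \sum_(0 <= k < N.+1) G k t * ((v - t) ^+ k / k`!%:R)) +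
   (G N.+1 * (fun t => (N.+1)`!%:R^-1 * (v - t) ^+ N.+1)).
  by apply/funext => t; rewrite big_nat_recr //= !fctE [_^-1 * _]mulrC.
have dE : is_derive s 1 (fun t => (N.+1)`!%:R^-1 * (v - t) ^+ N.+1)
    (- ((v - s) ^+ N / N`!%:R)).
  have D := is_deriveZ (N.+1)`!%:R^-1
    (is_deriveX N.+1 (is_deriveB (is_derive_cst v s 1) (is_derive_id s 1))).
  have -> : (fun t => (N.+1)`!%:R^-1 * (v - t) ^+ N.+1) =
      (N.+1)`!%:R^-1 \*: (cst v - id) ^+ N.+1 by apply/funext => t; rewrite !fctE.
  apply: (is_derive_eq D).
  rewrite factS natrM !fctE /GRing.scale /= sub0r.
  have h1 : (N.+1)%:R != 0 :> R by rewrite pnatr_eq0.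
  have h2 : (N`!)%:R != 0 :> R by rewrite pnatr_eq0 -lt0n fact_gt0.
  rewrite -mulr_natr; field; by rewrite h2 addrC natr1 h1.
have H := is_deriveD IH (is_deriveM (dG N.+1) dE).
apply: (is_derive_eq H).
rewrite /GRing.scale /=; ring.
Qed.

(** The mean value theorem turns the remainder into a single term, which the factorial bound on the
    derivatives makes at most a constant times [(2M|v|)^N]; this tends to 0 for small [v]. *)
Lemma has_egf_taylor (R : realType) (G : nat -> R -> R) (e C M : R) :
  0 < e -> 0 <= M ->
  (forall k (v : R), `|v| < e -> is_derive v 1 (G k) (G k.+1 v)) ->
  (forall k (v : R), `|v| < e -> `|G k v| <= C * M ^+ k * k`!%:R) ->
  has_egf 0 (G 0%N) (fun k => G k 0).
Proof.
move=> e0 M0 dG bG.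
have M1 : 0 < M + 1 by rewrite ltr_wpDl.
have C0 : 0 <= C.
  have := bG 0%N 0; rewrite normr0 expr0 fact0 !mulr1 => /(_ e0).
  exact: le_trans.
near=> v.
have ve : `|v| < e by near: v; exact: (@nbhs0_lt _ R).
have vM : `|2 * M * v| < 1.
  (* Since [M] may be 0, the radius is taken from [M + 1]. *)
  have : `|v| < (2 * (M + 1))^-1.
    by near: v; apply: (@nbhs0_lt _ R); rewrite invr_gt0 mulr_gt0.
  rewrite -[_^-1]mul1r ltr_pdivlMr ?mulr_gt0// => h.
  rewrite !normrM (ger0_norm M0) ger0_norm//; have := normr_ge0 v; nra.
have itv_e (s : R) : s \in `[0, 1] -> `|s * v| < e.
  rewrite in_itv /= => /andP[s0 s1]; rewrite normrM (ger0_norm s0).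
  by rewrite (le_lt_trans _ ve)// ler_piMl.
(* Taylor sum of [G 0] at [s * v], evaluated at [v]: it moves from the Taylor sum
   at 0 for s = 0 to [G 0 v] for s = 1, and its derivative in s has one term. *)
pose phi N (s : R) := \sum_(0 <= k < N.+1) G k (s * v) * ((v - s * v) ^+ k / k`!%:R).
have dphi N (s : R) : s \in `[0, 1] ->
    is_derive s 1 (phi N)
      (G N.+1 (s * v) * ((v - s * v) ^+ N / N`!%:R) * v).
  move=> /itv_e sve.
  have dsv : is_derive s 1 (fun t => t * v) v.
    have D := is_deriveM (is_derive_id s 1) (is_derive_cst v s 1).
    by apply: (is_derive_eq D); rewrite /GRing.scale /= mulr0 add0r mulr1.
  have D := @is_derive1_comp R _ (fun t => t * v) s _ _
    (is_derive_taylor v N (fun k => dG k _ sve)) dsv.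
  exact: D.
have bnd N : `|phi N 1 - phi N 0| <= C * (M + 1) * `|v| * `|2 * M * v| ^+ N.
  have l01 : (0 : R) <= 1 by [].
  have cphi : {within `[0, 1], continuous (phi N)}.
    by apply: derivable_within_continuous => s /(dphi N) [+ _].
  have [c c01 eqc] := MVT_segment l01
    (fun s h => dphi N s (@subset_itv_oo_cc _ _ 0 1 s h)) cphi.
  rewrite eqc {eqc cphi l01}.
  have cve := itv_e _ c01.
  rewrite subr0 mulr1 !normrM normfV normrX.
  have cv : `|v - c * v| <= `|v|.
    move: c01; rewrite in_itv /= => /andP[c0 c1].
    rewrite -[X in X - _]mul1r -mulrBl normrM ger0_norm ?subr_ge0//.
    by rewrite ler_piMl// gerBl.
  rewrite (ger0_norm (ler0n _ _)) !(ger0_norm M0) (@ger0_norm _ 2)//.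
  have gb := bG N.+1 _ cve.
  (* The quotient [(N+1)! / N!] leaves a factor [N + 1], absorbed by the 2 in the ratio [2M|v|]. *)
  have N2 : (N.+1)%:R <= 2 ^+ N :> R by rewrite -natrX ler_nat ltn_expl.
  have f0 : 0 < (N`!)%:R :> R by rewrite ltr0n fact_gt0.
  have -> : C * (M + 1) * `|v| * (2 * M * `|v|) ^+ N =
     C * M ^+ N * (M + 1) * 2 ^+ N * N`!%:R * (`|v| ^+ N / N`!%:R) * `|v|.
    rewrite !exprMn; field; exact: lt0r_neq0.
  rewrite ler_wpM2r// ler_pM//.
    apply: (le_trans gb); rewrite factS natrM exprSr !mulrA.
    rewrite ler_wpM2r// ?(ltW f0)// -!mulrA !ler_wpM2l// ?exprn_ge0//.
    by rewrite ler_pM// lerDl.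
  rewrite ler_wpM2r ?invr_ge0 ?(ltW f0)//.
  by rewrite lerXn2r ?nnegrE.
have phi1 N : phi N 1 = G 0%N v.
  rewrite /phi big_nat_recl// big1_seq ?addr0; last first.
    by move=> i _; rewrite mul1r subrr expr0n /= mul0r mulr0.
  by rewrite mul1r expr0 fact0 divr1 mulr1.
have phi0 N : phi N 0 = \sum_(0 <= k < N.+1) G k 0 * (v ^+ k / k`!%:R).
  by rewrite /phi; apply: eq_bigr => i _; rewrite mul0r subr0.
rewrite -(cvg_shiftn 1); apply/subr_cvg0.
apply: norm_cvg0; apply: (@squeeze_cvgr _ _ _ _ (cst 0)
  (fun N => C * (M + 1) * `|v| * `|2 * M * v| ^+ N)).
- near=> N; rewrite normr_ge0/=.
  by have := bnd N; rewrite phi1 phi0 distrC addn1.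
- exact: cvg_cst.
- by have := @cvg_geometric R (C * (M + 1) * `|v|) `|2 * M * v|; rewrite normr_id => /(_ vM).
Unshelve. all: by end_near. Qed.

(** * Stirling numbers by recurrence, and their growth *)

(* The triangular recurrence; [stirling2E] identifies it with the generating-function
   definition [stirling2]. *)
Fixpoint stirl (n m : nat) : nat :=
  match n, m with
  | 0, 0 => 1
  | 0, _.+1 | _.+1, 0 => 0
  | n'.+1, m'.+1 => m * stirl n' m + stirl n' m'
  end.

Lemma stirl_small n m : (n < m)%N -> stirl n m = 0%N.
Proof.
elim: n m => [|n IH] [|m] //=; rewrite ltnS => nm.
by rewrite !IH ?muln0// ltnW.
Qed.

(** Induction along Pascal's rule: each of the two terms of the recurrence gains a factor [m + 1],
    which is at most [n + 1] unless both terms vanish. *)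
Lemma stirl_fact_le n m : (stirl n m * m`! <= n`! * 'C(n, m))%N.
Proof.
elim: n m => [|n IH] [|m] //=.
have [nm|mn] := ltnP n m; first by rewrite !stirl_small ?muln0 ?mul0n// ltnW.
rewrite mulnDl [n.+1`!]factS binS mulnDr leq_add//.
  by rewrite -!mulnA; exact: leq_mul.
by rewrite factS mulnCA -[X in (_ <= X)%N]mulnA; exact: leq_mul.
Qed.

Lemma sum_stirl_fact_le (R : realType) (n : nat) (z : R) : 0 <= z ->
  \sum_(0 <= j < n.+1) (stirl n j * j`!)%:R * z ^+ j <= n`!%:R * (1 + z) ^+ n.
Proof.
move=> z0; rewrite exprDn big_mkord mulr_sumr ler_sum// => i _.
rewrite expr1n mul1r -[X in _ <= _ * X]mulr_natl mulrA -natrM ler_wpM2r ?exprn_ge0//.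
by rewrite ler_nat stirl_fact_le.
Qed.

(** * Composition with [e^v - 1] *)

(* The k-th derivative of f_0 (e^v - 1) when f_j is the j-th derivative of f_0. *)
Definition exp_comp_deriv (R : realType) (f : nat -> R -> R) (k : nat) (v : R) : R :=
  \sum_(0 <= j < k.+1) (stirl k j)%:R * (expR v ^+ j * f j (expR v - 1)).

(** With [T j = e^(jv) f_j(e^v - 1)] one has [T j' = j T j + T (j+1)]; collecting the coefficient of
    each [T j] reproduces the Stirling recurrence. *)
Lemma is_derive_exp_comp (R : realType) (f : nat -> R -> R) (k : nat) (v : R) :
  (forall j, is_derive (expR v - 1) 1 (f j) (f j.+1 (expR v - 1))) ->
  is_derive v 1 (exp_comp_deriv f k) (exp_comp_deriv f k.+1 v).
Proof.
move=> df.
pose T j (u : R) := expR u ^+ j * f j (expR u - 1).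
have dT j : is_derive v 1 (T j) (j%:R * T j v + T j.+1 v).
  have d1 : is_derive v 1 (fun u => expR u - 1) (expR v).
    have D := is_deriveB (is_derive_expR v) (is_derive_cst (1 : R) v 1).
    by apply: (is_derive_eq D); rewrite subr0.
  have d2 := @is_derive1_comp R _ (fun u => expR u - 1) v _ _ (df j) d1.
  have D := is_deriveM (is_deriveX j (is_derive_expR v)) d2.
  have -> : T j = expR ^+ j * (f j \o (fun u => expR u - 1)).
    by apply/funext => u; rewrite !fctE.
  apply: (is_derive_eq D).
  rewrite !fctE /T /GRing.scale /=.
  case: j {d2 D} => [|j] /=; rewrite !exprS; ring.
have D m : is_derive v 1 (fun u => \sum_(0 <= j < m) (stirl k j)%:R * T j u)
    (\sum_(0 <= j < m) (stirl k j)%:R * (j%:R * T j v + T j.+1 v)).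
  elim: m => [|m IH].
    have -> : (fun u => \sum_(0 <= j < 0) (stirl k j)%:R * T j u) = cst 0.
      by apply/funext => u; rewrite big_nil.
    by rewrite big_nil; exact: is_derive_cst.
  have D := is_deriveD IH (is_deriveZ (stirl k m)%:R (dT m)).
  rewrite big_nat_recr//=.
  have -> : (fun u => \sum_(0 <= j < m.+1) (stirl k j)%:R * T j u) =
     (fun u => \sum_(0 <= j < m) (stirl k j)%:R * T j u) + ((stirl k m)%:R \*: T m).
    by apply/funext => u; rewrite big_nat_recr//= !fctE.
  exact: D.
apply: (is_derive_eq (D k.+1)).
rewrite /exp_comp_deriv -/(T _ _) [RHS]big_nat_recl//=.
rewrite mul0r add0r.
under [RHS]eq_bigr => j _ do rewrite -/(T j.+1 v) natrD natrM mulrDl.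
under [LHS]eq_bigr => j _ do rewrite mulrDr.
rewrite !big_split /=; congr (_ + _).
(* The two ranges differ by one at each end: the term [j = 0] on the left carries the factor 0, and
   the top term on the right carries [S(k,k+1) = 0]. *)
rewrite big_nat_recl//= mul0r mulr0 add0r [RHS]big_nat_recr//=.
rewrite (stirl_small (ltnSn k)) mulr0 mul0r addr0.
by apply: eq_bigr => j _; rewrite mulrCA mulrA.
Qed.

Lemma expR_sub1_lt (R : realType) (e : R) : 0 < e ->
  exists2 d : R, 0 < d & forall v : R, `|v| < d -> `|expR v - 1| < e.
Proof.
move=> e0.
have /cvgrPdist_lt /(_ e e0) := @continuous_expR R 0.
rewrite expR0 => /nbhs_ballP[d /= d0 H]; exists d => // v vd.
rewrite distrC; apply: H.
by rewrite -ball_normE /ball_ /= sub0r normrN.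
Qed.

(** Near 0, [e^v <= 2], so the sum bound at [z = 2M] bounds the k-th derivative of the composite by
    [C (1 + 2M)^k k!], as the Taylor criterion requires. *)
Lemma has_egf_exp_comp (R : realType) (f : nat -> R -> R) (e C M : R) :
  0 < e -> 0 <= M ->
  (forall j (u : R), `|u| < e -> is_derive u 1 (f j) (f j.+1 u)) ->
  (forall j (u : R), `|u| < e -> `|f j u| <= C * M ^+ j * j`!%:R) ->
  has_egf 0 (fun v => f 0%N (expR v - 1))
    (fun k => \sum_(0 <= j < k.+1) (stirl k j)%:R * f j 0).
Proof.
move=> e0 M0 df bf.
have C0 : 0 <= C.
  have := bf 0%N 0; rewrite normr0 expr0 fact0 !mulr1 => /(_ e0).
  exact: le_trans.
(* The bound [e] keeps [e^v - 1] in the domain of the hypotheses; the bound 1 gives [e^v <= 2]. *)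
have [d d0 dP] : exists2 d : R, 0 < d & forall v : R, `|v| < d ->
    `|expR v - 1| < Num.min e 1 by apply: expR_sub1_lt; rewrite lt_min e0 ltr01.
have -> : (fun v => f 0%N (expR v - 1)) = exp_comp_deriv f 0.
  by apply/funext => v; rewrite /exp_comp_deriv big_nat1 expr0 !mul1r.
have -> : (fun k => \sum_(0 <= j < k.+1) (stirl k j)%:R * f j 0) =
    (fun k => exp_comp_deriv f k 0).
  apply/funext => k; apply: eq_bigr => j _.
  by rewrite expR0 expr1n mul1r subrr.
apply: (@has_egf_taylor R _ d C (1 + 2 * M)) => //.
- by rewrite addr_ge0// mulr_ge0.
- move=> k v /dP; rewrite lt_min => /andP[ve _].
  by apply: is_derive_exp_comp => j; exact: df.
move=> k v /dP; rewrite lt_min => /andP[ve v1].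
have e2 : expR v <= 2.
  by move: (ler_norm (expR v - 1)) v1; lra.
rewrite /exp_comp_deriv (le_trans (ler_norm_sum _ _ _))//.
have M2 : 0 <= 2 * M by rewrite mulr_ge0.
rewrite -mulrA [_ ^+ k * _]mulrC.
apply: (le_trans _ (ler_wpM2l C0 (sum_stirl_fact_le k M2))).
rewrite mulr_sumr ler_sum// => j _.
rewrite !normrM normr_nat normrX (ger0_norm (expR_ge0 v)).
rewrite natrM exprMn.
have -> : C * ((stirl k j)%:R * j`!%:R * (2 ^+ j * M ^+ j)) =
   (stirl k j)%:R * (2 ^+ j * (C * M ^+ j * j`!%:R)) by ring.
rewrite ler_wpM2l// ler_pM ?exprn_ge0 ?expR_ge0// ?bf//.
by rewrite lerXn2r ?nnegrE ?expR_ge0.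
Qed.

(** * Uniqueness of the coefficients *)

Lemma sum_geometric_tail_le (R : realType) (t : R) (m N : nat) :
  0 <= t -> t <= 2^-1 -> \sum_(m <= k < N) t ^+ k <= 2 * t ^+ m.
Proof.
move=> t0 t2.
have [Nm|/ltnW mN] := leqP N m; first by rewrite big_geq// mulr_ge0// exprn_ge0.
(* The subtracted [2 t^N] strengthens the claim enough for induction on the length of the sum. *)
suff : \sum_(m <= k < N) t ^+ k <= 2 * t ^+ m - 2 * t ^+ N.
  by have := exprn_ge0 N t0; lra.
rewrite -(subnKC mN); elim: (N - m)%N => [|j IH].
  by rewrite addn0 big_geq// subrr.
rewrite addnS big_nat_recr ?leq_addr//= exprS.
have := exprn_ge0 (m + j) t0; nra.
Qed.

Lemma powser_coef_eq0 (R : realType) (d : nat -> R) :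
  (\forall v \near (0 : R),
    (fun N : nat => \sum_(0 <= k < N) d k * v ^+ k) @ \oo --> (0 : R)) ->
  forall n, d n = 0.
Proof.
move=> /nbhs_ballP[e /= e0 H].
have H' (v : R) : `|v| < e ->
    (fun N : nat => \sum_(0 <= k < N) d k * v ^+ k) @ \oo --> (0 : R).
  by move=> ve; apply: H; rewrite -ball_normE /ball_ /= sub0r normrN.
pose w := e / 2.
have w0 : 0 < w by rewrite divr_gt0.
have we : `|w| < e by rewrite gtr0_norm// /w; lra.
(* Convergence at the interior point [w] bounds all the terms there uniformly. *)
have [K K0 dK] : exists2 K : R, 0 < K & forall k, `|d k * w ^+ k| <= K.
  have : cvgn (series (fun k => d k * w ^+ k)) by apply/cvg_ex; exists 0; exact: H'.
  move=> /cvg_series_bounded /ex_strict_bound_gt0[K K0 dK].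
  by exists K => // k; exact/ltW/dK.
elim/ltn_ind => n IH.
(* Evaluate at [t * w]: the terms past the n-th are O(t ^ n.+1), so letting t -> 0
   kills the n-th coefficient. *)
have bnd (t : R) : 0 < t -> t <= 2^-1 -> `|d n * w ^+ n| <= 2 * K * t.
  move=> t0 t2.
  have tw : `|t * w| < e.
    by rewrite normrM (gtr0_norm t0) (le_lt_trans _ we)// ler_piMl//; lra.
  have L : (fun N : nat => `|\sum_(0 <= k < N) d k * (t * w) ^+ k
      - d n * (t * w) ^+ n|) @ \oo --> `|0 - d n * (t * w) ^+ n|.
    apply: cvg_norm; apply: cvgB; [exact: H'|exact: cvg_cst].
  have : `|0 - d n * (t * w) ^+ n| <= K * (2 * t ^+ n.+1).
    apply: (cvgr_to_le L); near=> N.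
    have nN : (n < N)%N by near: N; exact: nbhs_infty_gt.
    rewrite (@big_cat_nat _ _ _ n)//= ?(ltnW nN)// big1_seq ?add0r; last first.
      by move=> k; rewrite mem_index_iota => /andP[_ kn]; rewrite IH// mul0r.
    rewrite big_ltn// addrAC subrr add0r.
    apply: (le_trans (ler_norm_sum _ _ _)).
    apply: (@le_trans _ _ (K * \sum_(n.+1 <= k < N) t ^+ k)); last first.
      by rewrite ler_wpM2l ?(ltW K0)// sum_geometric_tail_le ?(ltW t0).
    rewrite mulr_sumr ler_sum// => k _.
    rewrite exprMn mulrCA mulrC normrM ler_pM//.
    by rewrite ger0_norm// exprn_ge0// ltW.
  rewrite sub0r normrN exprMn mulrCA normrM ger0_norm ?exprn_ge0 ?(ltW t0)//.
  rewrite exprS => h; have tn : 0 < t ^+ n by rewrite exprn_gt0.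
  by rewrite -(ler_pM2l tn) (le_trans h)// le_eqVlt; apply/orP; left; apply/eqP; ring.
apply/eqP; apply: contraT => dn0.
have wn : w ^+ n != 0 by rewrite expf_neq0// lt0r_neq0.
have c0 : 0 < `|d n * w ^+ n| by rewrite normr_gt0 mulf_neq0.
have cK := dK n.
(* At this [t], at most 1/4 by [dK], the estimate [bnd] would make the positive number [|d n w^n|]
   at most half of itself. *)
have t1 : 0 < `|d n * w ^+ n| / (4 * K) by rewrite divr_gt0// mulr_gt0.
have t2 : `|d n * w ^+ n| / (4 * K) <= 2^-1.
  by rewrite ler_pdivrMr ?mulr_gt0//; lra.
have := bnd _ t1 t2.
have -> : 2 * K * (`|d n * w ^+ n| / (4 * K)) = `|d n * w ^+ n| / 2.
  by field; exact: lt0r_neq0.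
by move=> ?; exfalso; lra.
Unshelve. all: by end_near. Qed.

Lemma has_egf_unique (R : realType) (r : nat) (F : R -> R) (a b : nat -> R) :
  has_egf r F a -> has_egf r F b -> forall n, (r <= n)%N -> a n = b n.
Proof.
move=> Fa Fb n rn.
(* Padding with 0 below [r], where the two sequences may differ, gives an ordinary power series. *)
pose d k := if (r <= k)%N then (a k - b k) / k`!%:R else 0.
have : d n = 0.
  apply: powser_coef_eq0; near=> v.
  have ca : (fun N : nat => \sum_(r <= n < N) a n * (v ^+ n / n`!%:R)) @ \oo --> F v.
    by near: v.
  have cb : (fun N : nat => \sum_(r <= n < N) b n * (v ^+ n / n`!%:R)) @ \oo --> F v.
    by near: v.
  have cab : (fun N : nat => \sum_(0 <= k < N) d k * v ^+ k) @ \oo --> F v - F v.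
    apply: cvg_trans (cvgB ca cb); apply: near_eq_cvg; near=> N.
    have rN : (r <= N)%N by near: N; exact: nbhs_infty_ge.
    rewrite fctE -sumrB [RHS](@big_cat_nat _ _ _ r)//= [X in _ = X + _]big1_seq ?add0r.
      apply: eq_big_nat => k /andP[rk _]; rewrite /d rk -mulrBl; ring.
    move=> k /=; rewrite mem_index_iota => /andP[_ kr].
    by rewrite /d leqNgt kr mul0r.
  by rewrite subrr in cab.
rewrite /d rn => /eqP; rewrite mulf_eq0 invr_eq0 pnatr_eq0 -[n`! == 0%N]negbK.
by rewrite -lt0n fact_gt0 orbF subr_eq0 => /eqP.
Unshelve. all: by end_near. Qed.

(** The sequence [a] shows that the choice made by [xget] satisfies [has_egf]; uniqueness then
    identifies the chosen terms from index [r] on. *)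
Lemma egf_coefE (R : realType) (r : nat) (F : R -> R) (a : nat -> R) :
  has_egf r F a -> forall n, (r <= n)%N -> egf_coef r F n = a n.
Proof.
move=> Fa; apply: (@has_egf_unique _ r F _ a) => //.
by apply: (@xgetPex _ (fun=> 0) [set a | has_egf r F a]); exists a.
Qed.

(** * Explicit generating functions *)

(** Multiplying by [v^r / r!] moves the term [k] to [k + r]; the binomial coefficient is
    [(k+r)! / (k! r!)], from renormalising the factorials. *)
Lemma has_egf_mul_monomial (R : realType) (r : nat) (c : R) (G : R -> R) (b : nat -> R) :
  has_egf 0 G b ->
  has_egf r (fun v => (v * c) ^+ r / r`!%:R * G v)
    (fun n => c ^+ r * ('C(n, r))%:R * b (n - r)%N).
Proof.
rewrite /has_egf => Gb; near=> v.
have cb : (fun N : nat => \sum_(0 <= n < N) b n * (v ^+ n / n`!%:R)) @ \oo --> G v.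
  by near: v.
rewrite -(cvg_shiftn r).
have kb : (fun N : nat => (v * c) ^+ r / r`!%:R * \sum_(0 <= n < N) b n * (v ^+ n / n`!%:R))
    @ \oo --> (v * c) ^+ r / r`!%:R * G v by exact: cvgMl_tmp.
apply: cvg_trans kb; apply: near_eq_cvg; near=> N.
rewrite /= -[X in index_iota X (N + r)]add0n [RHS]big_addn addnK mulr_sumr.
apply: eq_bigr => k _; rewrite addnK exprMn exprD.
have fne j : j`!%:R != 0 :> R by rewrite pnatr_eq0 -lt0n fact_gt0.
have := bin_fact (leq_addl k r); rewrite addnK => <-; rewrite !natrM.
have bne : ('C(k + r, r))%:R != 0 :> R by rewrite pnatr_eq0 -lt0n bin_gt0 leq_addl.
by field; rewrite bne !fne.
Unshelve. all: by end_near. Qed.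

(** Among the derivatives of [u^m / m!], only the m-th is nonzero at 0, so the composite expansion
    has the single coefficient [S(k,m)]. *)
Lemma stirling2E (R : realType) (n m : nat) : (m <= n)%N ->
  stirling2 R n m = (stirl n m)%:R.
Proof.
(* The guard is needed because natural subtraction truncates: for [j > m] the formula would give 1
   instead of 0. *)
pose f (j : nat) (u : R) : R := if (j <= m)%N then u ^+ (m - j) / (m - j)`!%:R else 0.
have fne j : j`!%:R != 0 :> R by rewrite pnatr_eq0 -lt0n fact_gt0.
have df j (u : R) : `|u| < 1 -> is_derive u 1 (f j) (f j.+1 u).
  move=> _; rewrite /f; case: (ltngtP j m) => jm.
  - have D := is_deriveZ (m - j)`!%:R^-1 (is_deriveX (m - j) (@is_derive_id R R u 1)).
    have -> : (fun u : R => u ^+ (m - j) / (m - j)`!%:R) = (m - j)`!%:R^-1 \*: id ^+ (m - j).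
      by apply/funext => t; rewrite !fctE mulrC.
    apply: (is_derive_eq D); rewrite /GRing.scale /= mulr1 -(subnSK jm) /=.
    rewrite factS natrM; field.
    by rewrite fne addrC natr1 pnatr_eq0.
  - exact: is_derive_cst.
  - have -> : (fun u : R => u ^+ (m - j) / (m - j)`!%:R) = cst 1.
      by apply/funext => t; rewrite jm subnn expr0 fact0 divr1.
    exact: is_derive_cst.
have bf j (u : R) : `|u| < 1 -> `|f j u| <= 1 * 1 ^+ j * j`!%:R.
  move=> /ltW u1; rewrite expr1n !mul1r /f; case: ifP => jm; last by rewrite normr0.
  have f1 i : 1 <= i`!%:R :> R by rewrite ler1n fact_gt0.
  apply: (le_trans _ (f1 j)); rewrite normrM normfV normrX (ger0_norm (ler0n _ _)).
  by rewrite ler_pdivrMr ?ltr0n ?fact_gt0// mul1r (le_trans _ (f1 _))// exprn_ile1.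
have H := has_egf_exp_comp ltr01 ler01 df bf.
have {}H : has_egf m (fun v : R => (expR v - 1) ^+ m / m`!%:R) (fun k => (stirl k m)%:R).
  have e k : \sum_(0 <= j < k.+1) (stirl k j)%:R * f j 0 = (stirl k m)%:R.
    have [mk|km] := leqP m k.
      rewrite (bigD1_seq m) ?iota_uniq ?mem_index_iota//= {1}/f leqnn subnn expr0.
      rewrite fact0 divr1 mulr1 big1 ?addr0// => j jm; rewrite /f.
      case: ifP => // jm'; last by rewrite mulr0.
      by rewrite expr0n subn_eq0 leqNgt ltn_neqAle jm jm' /= mul0r mulr0.
    rewrite stirl_small// big1_seq// => j; rewrite mem_index_iota => /andP[_ jk].
    have jm : (j < m)%N by exact: leq_trans jk km.
    by rewrite /f (ltnW jm) expr0n subn_eq0 leqNgt jm /= mul0r mulr0.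
  rewrite /has_egf in H *; near=> v.
  have Hv : (fun N : nat => \sum_(0 <= k < N)
      (\sum_(0 <= j < k.+1) (stirl k j)%:R * f j 0) * (v ^+ k / k`!%:R))
      @ \oo --> f 0%N (expR v - 1) by near: v.
  have f0 : f 0%N (expR v - 1) = (expR v - 1) ^+ m / m`!%:R by rewrite /f subn0.
  rewrite f0 in Hv; apply: cvg_trans Hv; apply: near_eq_cvg; near=> N.
  (* The terms of index below [m] vanish, so the sum may start at [m]. *)
  have mN : (m <= N)%N by near: N; exact: nbhs_infty_ge.
  rewrite [LHS](@big_cat_nat _ _ _ m)//= [X in X + _ = _]big1_seq ?add0r.
    by apply: eq_bigr => k _; rewrite e.
  by move=> k; rewrite mem_index_iota => /andP[_ km]; rewrite e stirl_small// mul0r.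
exact: egf_coefE H _.
Unshelve. all: by end_near. Qed.

(** Factor by factor, [|z - i| <= |z| + i <= (|z| + 1)(i + 1)]. *)
Lemma falling_norm_le (R : realType) (z : R) (m : nat) :
  `|falling z m| <= (`|z| + 1) ^+ m * m`!%:R.
Proof.
rewrite /falling normr_prod; elim: m => [|m IH].
  by rewrite big_ord0 expr0 fact0 mulr1.
rewrite big_ord_recr/= factS natrM exprSr -mulrA [X in _ <= _ * X]mulrA.
rewrite [X in _ <= _ * X]mulrC mulrA ler_pM ?prodr_ge0//.
rewrite (le_trans (ler_normB _ _))// normr_nat -natr1.
by have := ler0n R m; have := normr_ge0 z; nra.
Qed.

(** On this interval [|ln y| <= ln 2]. *)
Lemma powR_norm_le (R : realType) (y a : R) :
  2^-1 <= y -> y <= 2 -> y `^ a <= 2 `^ `|a|.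
Proof.
move=> y1 y2; have y0 : 0 < y by rewrite (lt_le_trans _ y1)// invr_gt0.
rewrite /powR (gt_eqF y0) pnatr_eq0/= ler_expR.
apply: (le_trans (ler_norm _)); rewrite normrM ler_wpM2l//.
rewrite ler_norml ler_ln ?posrE// y2 andbT.
by rewrite -lnV ?posrE// ler_ln ?posrE// invr_gt0.
Qed.

(** For [|u| < 1/2] the base [y = 1 + pu] lies in [[1/2, 2]]. Writing [y^(a-j)] as [y^a / y^j]
    bounds it by [2^|a| 2^j], and the falling factorial supplies the [j!]. *)
Lemma has_egf_powR_exp (R : realType) (p a : R) : `|p| <= 1 ->
  has_egf 0 (fun v => (1 + p * (expR v - 1)) `^ a)
    (fun k => \sum_(0 <= m < k.+1) p ^+ m * falling a m * (stirl k m)%:R).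
Proof.
move=> p1.
pose f (j : nat) (u : R) : R := p ^+ j * falling a j * (1 + p * u) `^ (a - j%:R).
have y_itv (u : R) : `|u| < 2^-1 -> 2^-1 <= 1 + p * u <= 2.
  move=> u2; have : `|p * u| <= 2^-1.
    by rewrite normrM (le_trans _ (ltW u2))// ler_piMl.
  by rewrite ler_norml => /andP[? ?]; apply/andP; split; lra.
have e0 : 0 < 2^-1 :> R by rewrite invr_gt0.
have M0 : 0 <= 2 * (`|a| + 1) by rewrite mulr_ge0// addr_ge0.
have df j (u : R) : `|u| < 2^-1 -> is_derive u 1 (f j) (f j.+1 u).
  move=> /y_itv /andP[y1 _].
  have y0 : 0 < 1 + p * u by exact: lt_le_trans e0 y1.
  have dy : is_derive u 1 (fun u => 1 + p * u) p.
    have D := is_deriveD (is_derive_cst (1 : R) u 1) (is_deriveZ p (is_derive_id u 1)).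
    by apply: (is_derive_eq D); rewrite add0r /GRing.scale /= mulr1.
  have D := is_deriveZ (p ^+ j * falling a j)
    (@is_derive1_comp R _ (fun u => 1 + p * u) u _ _ (is_derive1_powR (a - j%:R) y0) dy).
  apply: (is_derive_eq D).
  rewrite /f /falling big_ord_recr /GRing.scale /= -addrA -opprD natr1 exprS; ring.
have bf j (u : R) : `|u| < 2^-1 ->
    `|f j u| <= 2 `^ `|a| * (2 * (`|a| + 1)) ^+ j * j`!%:R.
  move=> /y_itv /andP[y1 y2].
  have y0 : 0 < 1 + p * u by exact: lt_le_trans e0 y1.
  rewrite /f powRB ?(gt_eqF y0) ?implybT// powR_mulrn ?(ltW y0)//.
  have -> : 2 `^ `|a| * (2 * (`|a| + 1)) ^+ j * j`!%:R =
    1 * ((`|a| + 1) ^+ j * j`!%:R) * (2 `^ `|a| * 2 ^+ j) by rewrite exprMn; ring.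
  rewrite !normrM ler_pM ?mulr_ge0//.
    by rewrite ler_pM// ?falling_norm_le// normrX exprn_ile1.
  apply: ler_pM => //; first by rewrite ger0_norm ?powR_ge0// powR_norm_le.
  rewrite ger0_norm ?invr_ge0 ?exprn_ge0 ?(ltW y0)// -exprVn.
  rewrite lerXn2r ?nnegrE ?invr_ge0 ?(ltW y0)//.
  by rewrite -[leRHS]invrK lef_pV2 ?posrE.
have := has_egf_exp_comp e0 M0 df bf.
have -> : (fun v => f 0%N (expR v - 1)) = (fun v => (1 + p * (expR v - 1)) `^ a).
  by apply/funext => v; rewrite /f expr0 /falling big_ord0 !mul1r subr0.
have -> // : (fun k => \sum_(0 <= j < k.+1) (stirl k j)%:R * f j 0) =
   (fun k => \sum_(0 <= m < k.+1) p ^+ m * falling a m * (stirl k m)%:R).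
apply/funext => k; apply: eq_bigr => j _.
by rewrite /f mulr0 addr0 powR1 mulr1 mulrC.
Qed.

(** * The exponent, the Bernoulli moment generating function and the final formula *)

Lemma qnum_1B (R : realType) (q x : R) : 0 < q -> q != 1 ->
  qnum q (1 - x) = 1 - qnum q^-1 x.
Proof.
move=> q0 q1.
have qx0 : q `^ x != 0 by rewrite gt_eqF// powR_gt0.
have -> : qnum q^-1 x = ((q `^ x)^-1 - 1) / (q^-1 - 1).
  by rewrite /qnum -powR_inv1 ?(ltW q0)// -powRrM mulN1r powRN.
rewrite /qnum powRB ?(gt_eqF q0) ?implybT// powRr1 ?(ltW q0)//.
field.
by rewrite qx0 mulN1r !subr_eq0 [1 == q]eq_sym q1 (gt_eqF q0).
Qed.

(** The masses at 1 and 0 add up to 1, so the rest of the space is negligible and the expectation is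
    an integral over two sets on which the integrand is constant. *)
Lemma mmt_gen_fun_bernoulli (d : measure_display) (T : measurableType d)
    (R : realType) (P : probability T R) (Y : {RV P >-> R}) (p : R) :
  is_bernoulli Y p ->
  forall v, ('M_P Y v)%E = (1 + p * (expR v - 1))%:E.
Proof.
move=> [P1 P0] v.
have m1 : d.-measurable (Y @^-1` [set 1]) by exact: measurable_funPTI.
have m0 : d.-measurable (Y @^-1` [set 0]) by exact: measurable_funPTI.
set A := Y @^-1` [set 1] in P1 m1; set B := Y @^-1` [set 0] in P0 m0.
have dAB : [disjoint A & B].
  apply/disj_setPS => t []; rewrite /A /B /= => -> /eqP; by rewrite oner_eq0.
have mAB : d.-measurable (A `|` B) by exact: measurableU.
have PAB : P (A `|` B) = 1%E.
  have -> : P (A `|` B) = (P A + P B)%E by apply: measureU => //; exact/disj_set2P.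
  by rewrite P1 P0 -EFinD addrC subrK.
have PC : P (~` (A `|` B)) = 0%E by rewrite probability_setC// PAB subee.
have mg : measurable_fun setT (EFin \o (expR \o v \o* Y)).
  apply/measurable_EFinP; apply: measurableT_comp; first exact: measurable_expR.
  exact: (measurable_funM (f := Y) (g := cst v)).
rewrite /mmt_gen_fun unlock.
rewrite (@ge0_negligible_integral _ _ _ P setT (~` (A `|` B)))//; first last.
- by move=> t _; rewrite lee_fin expR_ge0.
- exact: measurableC.
rewrite setDE setTI setCK ge0_integral_setU//; first last.
- by move=> t _; rewrite lee_fin expR_ge0.
- exact: measurable_funS mg.
rewrite (eq_integral (cst (expR v)%:E)); last first.
  by move=> t; rewrite inE /A /= => ->; rewrite mul1r.
rewrite [X in (_ + X)%E](eq_integral (cst 1%E)); last first.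
  by move=> t; rewrite inE /B /= => ->; rewrite mul0r expR0.
rewrite !integral_cst// mul1e.
have -> : ((expR v)%:E * P A + P B)%E = ((expR v)%:E * p%:E + (1 - p)%:E)%E
  by rewrite P1 P0.
rewrite -EFinM -EFinD; congr EFin; ring.
Qed.

Theorem theorem3p3 (d : measure_display) (T : measurableType d) (R : realType)
    (P : probability T R) (Y : {RV P >-> R}) (p1 q x : R) (n r : nat)
    (HY : is_bernoulli Y p1) (Hq : 0 < q < 1) (Hx : 0 <= x <= 1)
    (Hrn : (r <= n)%N) :
  probBernstein Y r n x q =
  qnum q x ^+ r * ('C(n, r))%:R *
  \sum_(0 <= m < (n - r).+1)
    p1 ^+ m * falling (1 - qnum q^-1 x) m * stirling2 R (n - r) m.
Proof.
have /andP[q0 q1] := Hq.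
have p1_le1 : `|p1| <= 1.
  have [P1 _] := HY.
  have m1 : d.-measurable (Y @^-1` [set 1]) by exact: measurable_funPTI.
  rewrite ger0_norm -lee_fin -P1; [exact: probability_le1|exact: measure_ge0].
rewrite -qnum_1B ?lt_eqF// /probBernstein.
have H := has_egf_mul_monomial r (qnum q x)
  (has_egf_powR_exp (qnum q (1 - x)) p1_le1).
have -> : (fun v : R => (v * qnum q x) ^+ r / r`!%:R *
      (fine ('M_P Y v) `^ qnum q (1 - x))) =
    (fun v : R => (v * qnum q x) ^+ r / r`!%:R *
      (1 + p1 * (expR v - 1)) `^ qnum q (1 - x)).
  by apply/funext => v; rewrite (mmt_gen_fun_bernoulli HY).
rewrite (egf_coefE H Hrn); congr (_ * _).
(* The summation range gives [m <= n - r], where the generating function determines [stirling2]. *)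
apply: eq_big_nat => m /andP[_ mn]; by rewrite stirling2E.
Qed.
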